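(* Let $j,k\geq 2$ and $i\geq k+4$ be integers. Then $$R_k^{\mathcal{CA}}(i,j)=j-1+\Big\lceil\frac{j-1}{k}\Big\rceil,$$ where $\mathcal{CA}$ is the class of cacti.
   Context: All graphs are finite and simple. For a graph $G$ and a nonnegative integer $k$, a $k$-sparse $j$-set is a set of $j$ vertices of $G$ inducing a subgraph of maximum degree at most $k$; a $k$-dense $i$-set is a set of $i$ vertices of $G$ that is $k$-sparse in the complement of $G$. For a graph class $\mathcal{G}$, $R_k^{\mathcal{G}}(i,j)$ is the smallest natural number $n$ such that every graph on $n$ vertices in $\mathcal{G}$ has either a $k$-dense $i$-set or a $k$-sparse $j$-set. A cactus is a graph (not necessarily connected) in which every block is a cycle, a single edge, or a single vertex. *)

(* Defs.v *)
From mathcomp Require Import all_boot.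
Set Implicit Arguments. Unset Strict Implicit. Unset Printing Implicit Defensive.

Definition simple_graph (T : finType) (e : rel T) : Prop :=
  symmetric e /\ irreflexive e.

Section Graphs.
Variables (T : finType) (e : rel T).

Definition induced_rel (B : {set T}) : rel T :=
  [rel x y | [&& e x y, x \in B & y \in B]].

(* G[B] is connected (the empty graph counts as connected). *)
Definition induced_connected (B : {set T}) : bool :=
  [forall x in B, forall y in B, connect (induced_rel B) x y].

Definition nonseparable (B : {set T}) : bool :=
  [&& B != set0, induced_connected B & [forall v in B, induced_connected (B :\ v)]].

(* Blocks: maximal connected subgraphs without a cut vertex (they are induced). *)
Definition is_block (B : {set T}) : bool := maxset nonseparable B.

(* Every block is a single vertex, a single edge, or a cycle
   (a connected 2-regular graph on >= 3 vertices). *)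
Definition cactus : Prop :=
  forall B : {set T}, is_block B ->
    #|B| <= 2 \/ (forall x, x \in B -> #|[set y in B | e x y]| = 2).

Definition k_sparse_set (k j : nat) (S : {set T}) : Prop :=
  #|S| = j /\ forall x, x \in S -> #|[set y in S | e x y]| <= k.

Definition k_dense_set (k i : nat) (S : {set T}) : Prop :=
  #|S| = i /\ forall x, x \in S -> #|[set y in S | (y != x) && ~~ e x y]| <= k.
End Graphs.

Definition ramsey_prop_cacti (k i j n : nat) : Prop :=
  forall (T : finType) (e : rel T), simple_graph e -> cactus e -> #|T| = n ->
    (exists S : {set T}, k_dense_set e k i S) \/
    (exists S : {set T}, k_sparse_set e k j S).

Definition is_ramsey_number_cacti (k i j n : nat) : Prop :=
  ramsey_prop_cacti k i j n /\ forall m, m < n -> ~ ramsey_prop_cacti k i j m.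

Definition ceil_div (a b : nat) : nat := (a + b.-1) %/ b.

(* Main.v *)
(** Lower bound: in a chain of hubs, where each hub is joined to the previous hub and to a
    common neighbour of that hub and has [k] further vertices in its block, at least one
    vertex per block must be deleted on average to bring the maximum degree down to [k];
    a [k]-dense [i]-set would have minimum degree at least 3, which a cactus forbids.

    Upper bound: a cactus on [n] vertices loses all degrees above [k] after deleting fewer
    than [n / (k + 1)] vertices.  By induction it is enough to find a vertex [d] and [k]
    other vertices such that in [G - d] they and their neighbours have degree at most [k].
    Such a [d] is found in a minimal set [C] containing a vertex of degree above [k] and
    attached to the rest of the graph by a single vertex [r].  The only property of cacti
    used there is that no vertex has three neighbours in a connected set avoiding it. *)
Require Import Defs.
From mathcomp Require Import all_boot zify.
Set Implicit Arguments. Unset Strict Implicit. Unset Printing Implicit Defensive.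

(** * Connectivity of induced subgraphs and neighbourhoods in a cactus *)

Lemma connect_preserved (T : finType) (e : rel T) (P : pred T) x y :
  (forall p q, e p q -> P p -> P q) -> connect e x y -> P x -> P y.
Proof.
move=> eP /connectP[p + ->]; elim: p x => //= z p IHp x /andP[/eP xz zp] Px.
by apply: IHp zp _; apply: xz.
Qed.

Section SymmetricGraph.
Variables (T : finType) (e : rel T).
Hypothesis e_sym : symmetric e.

Definition nbr (B : {set T}) (x : T) : {set T} := [set y in B | e x y].

Definition comp (B : {set T}) (r : T) : {set T} :=
  [set p | connect (induced_rel e B) r p].

Lemma nbrS (B C : {set T}) x : B \subset C -> nbr B x \subset nbr C x.
Proof.
move=> /subsetP BC; apply/subsetP=> y; rewrite !inE => /andP[yB ->].
by rewrite BC.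
Qed.

Lemma nbr_setD1 (B : {set T}) d x :
  d \in B -> e x d -> #|nbr (B :\ d) x|.+1 = #|nbr B x|.
Proof.
move=> dB xd; rewrite (cardsD1 d (nbr B x)) inE dB xd add1n; congr _.+1.
by apply: eq_card => y; rewrite !inE andbA.
Qed.

Lemma induced_rel_sym (B : {set T}) : connect_sym (induced_rel e B).
Proof. by apply: sym_connect_sym => x y; rewrite /induced_rel /= e_sym (andbC (x \in B)). Qed.

Lemma mem_comp (B : {set T}) r : r \in comp B r.
Proof. by rewrite inE connect0. Qed.

Lemma comp_sub (B : {set T}) r : r \in B -> comp B r \subset B.
Proof.
move=> rB; apply/subsetP=> p; rewrite inE => /connect_preserved; apply=> //.
by move=> ? q /and3P[].
Qed.

Lemma comp_closed (B : {set T}) r p q :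
  p \in B -> q \in B -> e p q -> p \in comp B r -> q \in comp B r.
Proof.
move=> pB qB pq; rewrite !inE => /connect_trans; apply.
by apply: connect1; rewrite /induced_rel /= pq pB.
Qed.

Lemma induced_connected_eq (B : {set T}) r :
  r \in B -> B \subset comp B r -> induced_connected e B.
Proof.
move=> rB /subsetP sB; apply/forall_inP=> x /sB; rewrite inE => rx.
apply/forall_inP=> y /sB; rewrite inE; apply: connect_trans.
by rewrite induced_rel_sym.
Qed.

Lemma closed_induced_connected (B Q : {set T}) r :
  induced_connected e B -> r \in B -> r \in Q ->
  (forall p q, p \in Q -> p \in B -> q \in B -> e p q -> q \in Q) ->
  B \subset Q.
Proof.
move=> /forall_inP cB rB rQ cl; apply/subsetP=> y yB.
have /forall_inP/(_ y yB) := cB r rB.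
move/connect_preserved; apply=> // p q /and3P[pq pB qB] pQ.
exact: cl pQ pB qB pq.
Qed.

Lemma comp_connected (B : {set T}) r : r \in B -> induced_connected e (comp B r).
Proof.
move=> rB; apply: (@induced_connected_eq _ r); first exact: mem_comp.
apply/subsetP=> p rp.
have: connect (induced_rel e B) r p by rewrite inE in rp.
move/(@connect_preserved _ _ (mem (comp (comp B r) r))); apply; last exact: mem_comp.
move=> {rp}{}p q /and3P[pq pB qB] pC.
have pcomp : p \in comp B r by apply: subsetP pC; apply: comp_sub; apply: mem_comp.
exact: comp_closed pcomp (comp_closed pB qB pq pcomp) pq pC.
Qed.

(* In a minimal connected [R] with three neighbours of [x], every component of
   [R :\ v] contains a neighbour of [x], so [x |: R] has no cut vertex. *)
Lemma cactus_card_nbr_connected (x : T) (R : {set T}) :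
  cactus e -> x \notin R -> induced_connected e R -> #|nbr R x| <= 2.
Proof.
move=> cact; have [m] := ubnP #|R|; elim: m R => // m IHm R ltR xR cR.
rewrite leqNgt; apply/negP=> nR.
have [a] : exists a, a \in nbr R x by apply/set0Pn; rewrite -card_gt0; lia.
rewrite inE => /andP[aR xa].
have cxR : induced_connected e (x |: R).
  apply: (@induced_connected_eq _ x); first by rewrite setU11.
  have /subsetP RQ : R \subset comp (x |: R) x.
    apply: (closed_induced_connected cR aR).
      by rewrite inE connect1 // /induced_rel /= xa !inE eqxx aR orbT.
    move=> p q pQ pR qR pq.
    by apply: comp_closed pQ; rewrite ?in_setU1 ?pR ?qR ?orbT.
  by apply/subsetP=> p /setU1P[->|/RQ //]; apply: mem_comp.
have ns : nonseparable e (x |: R).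
  apply/and3P; split; [by apply/set0Pn; exists x; rewrite setU11 | exact: cxR |].
  apply/forall_inP=> v /setU1P[->|vR]; first by rewrite setU1K.
  have xv : x != v by apply: contraNneq xR => ->.
  set B := (x |: R) :\ v.
  have xB : x \in B by rewrite !inE eqxx xv.
  apply: (induced_connected_eq xB).
  (* [K] is the part of [R] that [v] cuts off from [x]. It contains no neighbour of [x] and meets
     the rest of [R] only through [v], so [R :\: K] is a smaller counterexample unless [K] is
     empty. *)
  set K := R :\ v :\: comp B x.
  have inB p : p \in R -> p != v -> p \in B by move=> pR pv; rewrite !inE pv pR orbT.
  have [K0|/set0Pn[p0 p0K]] := eqVneq K set0.
    apply/subsetP=> p; rewrite /B => /setD1P[pv /setU1P[->|pR]]; first exact: mem_comp.
    move/setP/(_ p): K0; rewrite in_setD !in_setD1 pv pR /= in_set0 andbT.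
    by move/negbFE.
  have KP p q : p \in K -> q \in R -> e p q -> q = v \/ q \in K.
    rewrite in_setD in_setD1 => /and3P[pc pv pR] qR pq.
    have [->|qv] := eqVneq q v; [by left | right].
    rewrite in_setD in_setD1 qv qR /= andbT; apply: contra pc.
    by apply: comp_closed; rewrite ?inB // e_sym.
  have Kx p : p \in K -> ~~ e x p.
    rewrite in_setD in_setD1 => /and3P[pc pv pR]; apply: contra pc => xp.
    by apply: (comp_closed xB _ xp); rewrite ?inB // mem_comp.
  have vK : v \notin K by rewrite in_setD in_setD1 eqxx andbF.
  set R' := R :\: K.
  have vR' : v \in R' by rewrite in_setD vK.
  have cR' : induced_connected e R'.
    apply: (induced_connected_eq vR').
    have /subsetP RQ : R \subset comp R' v :|: K.
      apply: (closed_induced_connected cR vR); first by rewrite in_setU mem_comp.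
      move=> p q + pR qR pq; rewrite !in_setU => /orP[pQ|pK].
        have pR' := subsetP (comp_sub vR') _ pQ.
        have [qK|qK] := boolP (q \in K); first by rewrite orbT.
        by rewrite (comp_closed pR' _ pq pQ) // in_setD qK.
      by have [->|->] := KP _ _ pK qR pq; rewrite ?mem_comp ?orbT.
    apply/subsetP=> p; rewrite in_setD => /andP[pK /RQ].
    by rewrite in_setU (negPf pK) orbF.
  have ltR' : #|R'| < m.
    apply: leq_trans (ltR : #|R| <= m); apply: proper_card.
    apply/properP; split; first exact: subsetDl.
    exists p0; last by rewrite in_setD p0K.
    by move: p0K; rewrite in_setD in_setD1 => /and3P[].
  have xR' : x \notin R' by rewrite in_setD (negPf xR) andbF.
  have := IHm _ ltR' xR' cR'; rewrite leqNgt => /negP[].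
  apply: leq_trans nR _; apply: subset_leq_card; apply/subsetP=> y.
  rewrite [y \in nbr R x]inE => /andP[yR xy].
  rewrite inE [y \in R']in_setD yR xy !andbT.
  by apply: contraTN xy => yK; apply: Kx.
have [B bB sB] := maxset_exists ns.
have xB : x \in B by rewrite (subsetP sB) ?setU11.
have RB : nbr R x \subset nbr B x.
  by apply: nbrS; apply: subset_trans sB; apply: subsetUr.
have := leq_trans nR (subset_leq_card RB).
have [le2|/(_ x xB) eq2] := cact B bB; last by rewrite /nbr eq2.
apply/negP; rewrite -leqNgt; apply: leq_trans le2.
by apply: subset_leq_card; apply/subsetP=> y; rewrite inE => /andP[].
Qed.


(** * Deleting few vertices to bring all degrees down to [k] *)

Hypothesis e_irr : irreflexive e.
Variable k : nat.

(** One induction step: delete [d] and set [Z] aside, so that the deletion is charged to at least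
    [k + 1] vertices. Neighbours of [Z] must be safe too, because they regain degree when [Z] is put
    back. *)
Definition reducible (A : {set T}) : bool :=
  [exists d in A, exists Z : {set T},
    [&& Z \subset A :\ d, k <= #|Z| &
     [forall z in Z, forall w in A :\ d,
        ((w == z) || e z w) ==> (#|nbr (A :\ d) w| <= k)]]].

Lemma reducibleI (A Z : {set T}) d :
  d \in A -> Z \subset A :\ d -> k <= #|Z| ->
  (forall z w, z \in Z -> w \in A -> w != d -> (w == z) || e z w ->
     #|nbr (A :\ d) w| <= k) ->
  reducible A.
Proof.
move=> dA ZA kZ safe; apply/exists_inP; exists d => //.
apply/existsP; exists Z; rewrite ZA kZ /=.
apply/forall_inP=> z zZ; apply/forall_inP=> w /setD1P[wd wA].
by apply/implyP; apply: safe.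
Qed.

(* Take [C] minimal.  For [x] in [C], let [H x] be the part of [C] that [x] separates from
   [r]; its vertices have degree at most [k] by minimality, and [x] has at most two
   neighbours outside it.  The deleted vertex is [x] if [x] has [k] neighbours in [H x],
   and [r] if all large-degree vertices of [C] are adjacent to [r].  Otherwise some
   large-degree [x] has its two outer neighbours [y], [z] in [C]: if one of them has small
   degree, the other is deleted, and if both are large, [x] is, which makes [H x] and
   [H y] safe. *)
Lemma separated_reducible (A C : {set T}) r b :
  2 <= k -> cactus e -> r \in A -> C \subset A -> r \notin C ->
  (forall p q, p \in C -> q \in A -> e p q -> q = r \/ q \in C) ->
  b \in C -> k < #|nbr A b| -> reducible A.
Proof.
move=> k2 cact; have [m] := ubnP #|C|.
elim: m C r b => // m IHm C r b ltC rA CA rC Ccl bC bad_b.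
apply: contraT => nred.
(* Minimality of [C], given that [A] is not reducible. *)
have small (C' : {set T}) r' x : #|C'| < #|C| -> r' \in A -> C' \subset A -> r' \notin C' ->
    (forall p q, p \in C' -> q \in A -> e p q -> q = r' \/ q \in C') ->
    x \in C' -> #|nbr A x| <= k.
  move=> ltC' r'A C'A r'C' cl xC'; rewrite leqNgt; apply: contra nred.
  by apply: (IHm C' r' x) => //; apply: leq_trans ltC' ltC.
have inA x : x \in C -> x \in A by apply: subsetP.
have neqr x : x \in C -> x != r by apply: contraTneq => ->.
have nbr_le (B D : {set T}) x : B \subset D -> #|nbr D x| <= k -> #|nbr B x| <= k.
  by move=> BD; apply: leq_trans; apply/subset_leq_card/nbrS.
pose H x := (C :\ x) :\: comp (A :\ x) r.
have HC x : H x \subset C :\ x by apply: subsetDl.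
have HC' x : H x \subset C by apply: subset_trans (HC x) (subsetDl _ _).
have HA x : H x \subset A by apply: subset_trans CA.
have xH x : x \notin H x by rewrite in_setD in_setD1 eqxx andbF.
have Hcl x p q : x \in C -> p \in H x -> q \in A -> e p q -> q = x \/ q \in H x.
  move=> xC; rewrite in_setD in_setD1 => /and3P[pc px pC] qA pq.
  have [->|qx] := eqVneq q x; [by left | right].
  have rc := mem_comp (A :\ x) r.
  have pAx : p \in A :\ x by rewrite !inE px inA.
  have qAx : q \in A :\ x by rewrite !inE qx qA.
  have qc : q \notin comp (A :\ x) r.
    by apply: contra pc; apply: comp_closed => //; rewrite e_sym.
  rewrite in_setD in_setD1 qc qx.
  by have [qr|] := Ccl p q pC qA pq; first by rewrite qr rc in qc.
have Hgood x w : x \in C -> w \in H x -> #|nbr A w| <= k.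
  move=> xC wH; apply: (small (H x) x w _ (inA x xC) (HA x) (xH x) _ wH).
    by rewrite (cardsD1 x C) xC ltnS; apply: subset_leq_card.
  by move=> p q; apply: Hcl.
have rcomp x : x \in C -> r \in A :\ x by move=> xC; rewrite !inE rA eq_sym neqr.
(* Neighbours of [x] outside [H x] lie in the component of [r] in [A :\ x], a connected set avoiding
   [x]. *)
have nbrH x : x \in C -> #|nbr A x :\: H x| <= 2.
  move=> xC; set R := comp (A :\ x) r.
  have xR : x \notin R.
    by apply/negP=> /(subsetP (comp_sub (rcomp x xC))); rewrite !inE eqxx.
  have := cactus_card_nbr_connected cact xR (comp_connected (rcomp x xC)).
  apply: leq_trans; apply: subset_leq_card; apply/subsetP=> y.
  rewrite in_setD [y \in nbr _ _]inE => /and3P[yH yA xy].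
  rewrite inE xy andbT; apply: contraR yH => yR.
  have yx : y != x by apply: contraTneq xy => ->; rewrite e_irr.
  have [yr|yC] := Ccl x y xC yA xy; first by rewrite yr mem_comp in yR.
  by rewrite in_setD yR in_setD1 yx.
have nbrHI x : nbr A x :&: H x \subset H x by apply: subsetIr.
have Hlt x : x \in C -> #|nbr A x :&: H x| < k.
  move=> xC; rewrite ltnNge; apply: contra nred => kH.
  apply: (@reducibleI A (H x) x (inA x xC)).
  - by apply: subset_trans (HC x) _; apply: setSD.
  - by apply: leq_trans kH _; apply: subset_leq_card.
  move=> z w zH wA wx zw; apply: (nbr_le _ _ _ (subsetDl _ _)).
  apply: (Hgood x) => //; case/orP: zw => [/eqP->//|zw].
  by have [wx'|] := Hcl x z w xC zH wA zw; first by rewrite wx' eqxx in wx.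
have degC x : x \in C -> #|nbr A x| <= k.+1.
  by move=> xC; rewrite -(cardsID (H x)); have := nbrH x xC; have := Hlt x xC; lia.
have Hge x : x \in C -> k < #|nbr A x| ->
    k.-1 <= #|H x| /\ #|nbr A x :\: H x| = 2.
  move=> xC; rewrite -(cardsID (H x)); have := nbrH x xC; have := Hlt x xC.
  have := subset_leq_card (nbrHI x); lia.
(* Degrees in [C] are at most [(k - 1) + 2], so the loss of one neighbour makes a vertex safe. *)
have deg_del d w : d \in A -> w \in C -> e w d -> #|nbr (A :\ d) w| <= k.
  by move=> dA wC wd; have := degC w wC; rewrite -(nbr_setD1 dA wd).
have [/forall_inP all_r|] := boolP [forall x in C, (k < #|nbr A x|) ==> e x r].
  rewrite -(negbTE nred); apply: (@reducibleI A C r) => //.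
  - by rewrite subsetD1 CA.
  - rewrite -ltnS; apply: leq_trans bad_b _; apply: leq_trans (_ : #|r |: C| <= _).
      apply: subset_leq_card; apply/subsetP=> y; rewrite !inE => /andP[yA by_].
      by have [->|->] := Ccl b y bC yA by_; rewrite ?eqxx ?orbT.
    by rewrite cardsU1 rC.
  move=> z w zC wA wr zw.
  have wC : w \in C.
    case/orP: zw => [/eqP->//|zw].
    by have [wr'|] := Ccl z w zC wA zw; first by rewrite wr' eqxx in wr.
  have [good_w|bad_w] := leqP #|nbr A w| k; first exact: nbr_le (subsetDl _ _) good_w.
  by apply: deg_del => //; have := all_r w wC; rewrite bad_w.
rewrite negb_forall_in => /exists_inP[x xC]; rewrite negb_imply => /andP[bad_x xr].
have [Hx_ge /eqP/cards2P[y [z [_ Dyz]]]] := Hge x xC bad_x.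
have nbr_x w : w \in A -> e x w -> w \notin H x -> (w == y) || (w == z).
  by move=> wA xw wH; rewrite -in_set2 -Dyz in_setD wH inE wA.
have inD w : w \in nbr A x :\: H x -> [/\ w \in C, e x w & w \notin H x].
  rewrite in_setD [w \in nbr A x]inE => /and3P[wH wA xw]; split=> //.
  by have [wr|] := Ccl x w xC wA xw; first by rewrite -wr xw in xr.
(* If [v] had small degree, [u] could be deleted with [Z := x |: H x], of size at least
   [1 + (k - 1)]: [x] loses [u], and apart from [u] only [v] can be adjacent to [Z] from outside. *)
have neighbour_bad u v : u \in C -> e x u -> u \notin H x ->
    (forall w, w \in A -> e x w -> w \notin H x -> (w == u) || (w == v)) ->
    k < #|nbr A v|.
  move=> uC xu uH nbr_uv; rewrite ltnNge; apply: contra nred => good_v.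
  apply: (@reducibleI A (x |: H x) u (inA u uC)).
  - rewrite subsetD1 subUset sub1set (inA x xC) HA /= in_setU1 negb_or uH andbT.
    by apply: contraTneq xu => ->; rewrite e_irr.
  - by rewrite cardsU1 xH; move: Hx_ge; move: #|H x| => h; clear; lia.
  move=> z' w z'Z wA wu z'w.
  have [->|wx] := eqVneq w x; first by apply: deg_del => //; apply: inA.
  apply: (nbr_le _ _ _ (subsetDl _ _)).
  have [wH|wH] := boolP (w \in H x); first exact: Hgood wH.
  suff /eqP-> : w == v by [].
  have xw : e x w.
    case/setU1P: z'Z => [z'x|z'H]; first by move: z'w; rewrite z'x (negPf wx).
    case/orP: z'w => [/eqP w_z'|z'w]; first by rewrite w_z' z'H in wH.
    by have [w_x|w_H] := Hcl x z' w xC z'H wA z'w;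
       [rewrite w_x eqxx in wx | rewrite w_H in wH].
  by have := nbr_uv w wA xw wH; rewrite (negPf wu).
have [yC xy yH] : [/\ y \in C, e x y & y \notin H x].
  by apply: inD; rewrite Dyz in_set2 eqxx.
have [zC xz zH] : [/\ z \in C, e x z & z \notin H x].
  by apply: inD; rewrite Dyz in_set2 eqxx orbT.
have bad_y : k < #|nbr A y|.
  by apply: (neighbour_bad z y) => // w wA xw wH; rewrite orbC nbr_x.
have [Hy_ge _] := Hge y yC bad_y.
have xHy : x \notin H y by apply: contraL bad_x => /(Hgood y x yC); rewrite leqNgt.
have y_neq_x : y != x by apply: contraTneq xy => ->; rewrite e_irr.
(* The intersection has no edge to the rest of [C], so removing it would leave a smaller set still
   containing [x], against minimality. *)
have disj : H x :&: H y = set0.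
  apply: contraTeq bad_x => /set0Pn[p0 p0H]; rewrite -leqNgt.
  apply: (small (C :\: (H x :&: H y)) r) => //.
  - apply: proper_card; apply/properP; split; first exact: subsetDl.
    exists p0; last by rewrite in_setD p0H.
    by apply: subsetP p0H; apply: subset_trans (subsetIl _ _) (HC' x).
  - exact: subset_trans (subsetDl _ _) CA.
  - by rewrite in_setD (negPf rC) andbF.
  - move=> p q; rewrite in_setD in_setI => /andP[pH pC] qA pq.
    have [->|qC] := Ccl p q pC qA pq; [by left | right].
    rewrite in_setD qC andbT; apply: contra pH; rewrite in_setI => /andP[qx qy].
    rewrite e_sym in pq.
    have [px|pHx] := Hcl x q p xC qx (inA p pC) pq;
      have [py|pHy] := Hcl y q p yC qy (inA p pC) pq.
    + by rewrite -px -py eqxx in y_neq_x.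
    + by rewrite -px pHy in xHy.
    + by rewrite -py pHx in yH.
    + by rewrite pHx.
  - by rewrite in_setD xC in_setI (negPf xHy) andbF.
(* [Z] has at least [2 * (k - 1)] elements, which reaches [k] because [k >= 2]. The vertex [y],
   which may be adjacent to [H y], is safe since it loses [x]. *)
rewrite -(negbTE nred); apply: (@reducibleI A (H x :|: H y) x (inA x xC)).
- by rewrite subsetD1 subUset !HA in_setU (negPf (xH x)) (negPf xHy).
- rewrite cardsU disj cards0; move: Hx_ge Hy_ge k2.
  by move: #|H x| #|H y| => h h'; clear; lia.
move=> u w uH wA wx uw.
have [->|wy] := eqVneq w y; first by apply: deg_del; rewrite ?inA // e_sym.
apply: (nbr_le _ _ _ (subsetDl _ _)).
case/setUP: uH => uH.
  apply: (Hgood x) => //; case/orP: uw => [/eqP->//|uw].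
  by have [w_x|] := Hcl x u w xC uH wA uw; first by rewrite w_x eqxx in wx.
apply: (Hgood y) => //; case/orP: uw => [/eqP->//|uw].
by have [w_y|] := Hcl y u w yC uH wA uw; first by rewrite w_y eqxx in wy.
Qed.


Lemma sparse_deletion (A : {set T}) :
  2 <= k -> cactus e -> A != set0 ->
  exists D : {set T}, [/\ D \subset A, #|D| * k.+1 < #|A| &
    forall x, x \in A :\: D -> #|nbr (A :\: D) x| <= k].
Proof.
move=> k2 cact; have [m] := ubnP #|A|; elim: m A => // m IHm A ltA A0.
have [/existsP[b /andP[bA bad_b]]|no_bad] :=
    boolP [exists b in A, k < #|nbr A b|]; last first.
  exists set0; split; rewrite ?sub0set ?cards0 ?card_gt0 // setD0 => x xA.
  rewrite leqNgt; apply: contra no_bad => bad_x; apply/existsP; exists x.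
  by rewrite xA.
have [r] : exists r, r \in nbr A b.
  by apply/set0Pn; rewrite -card_gt0; apply: leq_trans bad_b.
rewrite inE => /andP[rA br].
have : reducible A.
  (* The whole of [A :\ r] is trivially attached through [r] alone. *)
  apply: (@separated_reducible A (A :\ r) r b) => //; first exact: subsetDl.
  - by rewrite !inE eqxx.
  - move=> p q _ qA _; have [->|qr] := eqVneq q r; [by left | right].
    by rewrite !inE qr.
  - by rewrite !inE bA andbT; apply: contraTneq br => ->; rewrite e_irr.
case/exists_inP=> d dA /existsP[Z /and3P[ZA kZ safe]].
have {}safe x : x \in A -> x != d -> [exists z in Z, (x == z) || e z x] ->
    #|nbr (A :\ d) x| <= k.
  move=> xA xd /exists_inP[z zZ zx]; have /forall_inP/(_ x) := forall_inP safe z zZ.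
  by rewrite !inE xd xA zx; apply.
set A' := A :\ d :\: Z.
have cardA : #|A| = (#|A'| + #|Z|).+1.
  by rewrite (cardsD1 d A) dA -(cardsID Z (A :\ d)) (setIidPr ZA) add1n addnC.
have A'A : A' \subset A by apply: subset_trans (subsetDl _ _) (subsetDl _ _).
have [D' [D'A' D'lt D'sparse]] : exists D : {set T}, [/\ D \subset A',
    #|D|.+1 * k.+1 < #|A| & forall x, x \in A' :\: D -> #|nbr (A' :\: D) x| <= k].
  (* The induction hypothesis excludes the empty set. In that case only [d] is deleted, and
     [k + 1 < #|A|] because [A] contains [b] and its more than [k] neighbours. *)
  have [A'0|A'0] := eqVneq A' set0.
    exists set0; rewrite sub0set cards0 mul1n A'0; split=> //; last first.
      by move=> x; rewrite !inE.
    rewrite (cardsD1 b A) bA; apply: leq_trans bad_b _; apply: subset_leq_card.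
    apply/subsetP=> y; rewrite !inE => /andP[-> by_]; rewrite andbT.
    by apply: contraTneq by_ => ->; rewrite e_irr.
  have [||D [DA' Dlt Ds]] := IHm A' => //; first by move: ltA; rewrite cardA; lia.
  by exists D; split=> //; rewrite cardA mulSn; lia.
exists (d |: D'); split.
- by rewrite subUset sub1set dA (subset_trans D'A').
- apply: leq_ltn_trans D'lt; rewrite leq_mul2r; apply/orP; right.
  by rewrite cardsU1; case: (d \notin D').
move=> x; rewrite in_setD in_setU1 negb_or => /andP[/andP[xd xD'] xA].
have sub_del : A :\: (d |: D') \subset A :\ d by apply: setDS; rewrite sub1set setU11.
(* A vertex in [Z] or adjacent to it is safe once [d] is gone; any other vertex has the same
   neighbours whether or not [Z] is put back. *)
have [xZ|xZ] := boolP [exists z in Z, (x == z) || e z x].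
  by apply: leq_trans (safe x xA xd xZ); apply/subset_leq_card/nbrS.
have notZ z : z \in Z -> (x != z) && ~~ e z x.
  by move=> zZ; rewrite -negb_or; apply: contra xZ => zx; apply/exists_inP; exists z.
have inA' y : y \in A -> y != d -> y \notin Z -> y \in A'.
  by move=> yA yd yZ; rewrite in_setD yZ in_setD1 yd.
have xnZ : x \notin Z by apply/negP=> /notZ; rewrite eqxx.
apply: leq_trans (D'sparse x _); last by rewrite in_setD xD' inA'.
apply: subset_leq_card; apply/subsetP=> y.
rewrite !in_set -/(y \in A') => /andP[/andP[]].
rewrite negb_or => /andP[yd yD'] yA xy; rewrite yD' yd yA xy !andbT /=.
by apply/negP=> /notZ; rewrite e_sym xy andbF.
Qed.

End SymmetricGraph.

(** * Counting lemmas and degrees in nonseparable sets *)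

Lemma card_le_values (N : nat) (X : {set 'I_N}) (s : seq nat) :
  (forall x : 'I_N, x \in X -> val x \in s) -> #|X| <= size s.
Proof.
move=> Xs; rewrite cardE -(size_map val).
apply: uniq_leq_size; first by rewrite map_inj_uniq ?enum_uniq //; apply: val_inj.
by move=> u /mapP[x]; rewrite mem_enum => xX ->; apply: Xs.
Qed.

Lemma card_interval (N a l : nat) (X : {set 'I_N}) (F : seq nat) :
  uniq F -> (forall u, u \in F -> a <= u < a + l) ->
  (forall x : 'I_N, x \in X -> a <= x < a + l /\ val x \notin F) ->
  #|X| + size F <= l.
Proof.
move=> uF Fl Xl; rewrite cardE -(size_map val) -size_cat -[leqRHS](size_iota a).
apply: uniq_leq_size.
  rewrite cat_uniq uF map_inj_uniq ?enum_uniq ?andbT //=; last exact: val_inj.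
  apply/hasPn=> u uFs; apply/mapP=> -[x]; rewrite mem_enum => /Xl[_ /negP xF] ux.
  by apply: xF; rewrite ux in uFs.
move=> u; rewrite mem_cat mem_iota => /orP[/mapP[x]|/Fl //].
by rewrite mem_enum => /Xl[? _] ->.
Qed.

(** If [x] had no neighbour other than [y], deleting [y] would separate [x] from some third
    vertex. *)
Lemma nonseparable_nbr_gt1 (T : finType) (e : rel T) (B : {set T}) x :
  nonseparable e B -> 2 < #|B| -> x \in B -> 1 < #|nbr e B x|.
Proof.
move=> /and3P[_ _ /forall_inP cB] B2 xB; rewrite ltnNge; apply/negP=> nle.
have [y [yB yx nxy]] : exists y, [/\ y \in B, y != x & nbr e B x \subset [set x; y]].
  have Bx : 0 < #|B :\ x| by move: B2; rewrite (cardsD1 x) xB; lia.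
  have [sub|/subsetPn[y]] := boolP (nbr e B x \subset [set x]).
    have /set0Pn[y /setD1P[yx yB]] : B :\ x != set0 by rewrite -card_gt0.
    exists y; split=> //; apply: subset_trans sub _.
    by apply/subsetP=> z; rewrite !inE => ->.
  rewrite inE => yn yx; exists y; split=> //.
    by move: yn; rewrite inE => /andP[].
  have ny : [set y] \subset nbr e B x by rewrite sub1set.
  have /eqP <- : [set y] == nbr e B x by rewrite eqEcard ny cards1.
  by apply/subsetP=> z; rewrite !inE => ->; rewrite orbT.
have xBy : x \in B :\ y by rewrite !inE eq_sym yx.
have : B :\ y \subset [set x].
  apply: (closed_induced_connected (cB y yB) xBy); first exact: set11.
  move=> p q; rewrite in_set1 => /eqP-> _ /setD1P[qy qB] xq.
  have : q \in nbr e B x by rewrite inE qB.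
  by move/(subsetP nxy); rewrite !inE (negPf qy) orbF.
by move/subset_leq_card; move: B2; rewrite (cardsD1 y) yB cards1; lia.
Qed.

(** * The extremal cactus: a chain of hubs *)

Section Chain.
Variables (K N : nat).
Hypothesis K_gt1 : 1 < K.

(* Vertices are numbered so that the hubs are [t * K + 1]; the upper neighbours of a hub in
   its block are [t * K + 2], ..., [t * K + K], and the last of these is also joined to
   the next hub [t.+1 * K + 1].  Vertex [0] plays that role for the first hub.  Any [N]
   truncates the chain. *)
Definition chain_lower (u v : nat) : bool :=
  (u < v) && (if K %| v.-1 then (u.+1 == v) || (u + K == v)
              else u == (v.-1 %/ K * K).+1).

Definition chain_rel : rel 'I_N := [rel u v : 'I_N | chain_lower u v || chain_lower v u].

Lemma chain_simple : simple_graph chain_rel.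
Proof.
split=> [u v|u]; rewrite /chain_rel /=; first by rewrite orbC.
by rewrite /chain_lower ltnn.
Qed.

(** Applied at the largest vertex of a set, where [chain_lower] leaves at most two possible
    neighbours. *)
Lemma chain_rel_max (S : {set 'I_N}) (u v : 'I_N) :
  (forall w : 'I_N, w \in S -> w <= v) -> u \in S -> chain_rel v u -> chain_lower u v.
Proof.
by move=> vmax /vmax uv; rewrite /chain_rel /= {1}/chain_lower ltnNge uv.
Qed.

Lemma exists_max (S : {set 'I_N}) : S != set0 ->
  exists2 v : 'I_N, v \in S & forall w : 'I_N, w \in S -> w <= v.
Proof.
by case/set0Pn=> x0 x0S; case: (@arg_maxnP _ x0 (mem S) val x0S) => v vS vmax; exists v.
Qed.

(** A block with more than two vertices is a triangle. Its largest vertex [v] needs two lower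
    neighbours, so it is a hub, with [a] just below it and [b] the previous hub; once [b] is
    removed, no edge of the block leaves [v] and [a]. *)
Lemma chain_cactus : cactus chain_rel.
Proof.
move=> B /maxsetP[ns _]; case: (leqP #|B| 2) => [|B2]; [by left | right].
have [v vB vmax] : exists2 v : 'I_N, v \in B & forall w : 'I_N, w \in B -> w <= v.
  by apply: exists_max; rewrite -card_gt0; apply: leq_trans B2.
have nv := nonseparable_nbr_gt1 ns B2 vB.
have inn u : u \in nbr chain_rel B v -> u \in B /\ chain_lower u v.
  by rewrite inE => /andP[uB vu]; split=> //; apply: chain_rel_max vmax uB vu.
have Kv : K %| v.-1.
  apply: contraLR nv => Kv; rewrite -leqNgt.
  apply: (@card_le_values _ _ [:: (v.-1 %/ K * K).+1]) => u /inn[_].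
  by rewrite /chain_lower (negPf Kv) inE => /andP[].
have [a [b [aB bB a1 bK]]] : exists a b, [/\ a \in B, b \in B, a.+1 = v & b + K = v].
  have /card_gt1P[x [y [xn yn xy]]] := nv.
  have [xB /andP[_]] := inn x xn; have [yB /andP[_]] := inn y yn; rewrite Kv.
  have xy' : (x : nat) <> y by move/val_inj; apply/eqP.
  move=> /orP[/eqP y1|/eqP y1] /orP[/eqP x1|/eqP x1].
  - by lia.
  - by exists y, x.
  - by exists x, y.
  - by lia.
have aK : a = b + K.-1 :> nat by lia.
have [b_lt_a b_lt_v] : b < a /\ b < v by lia.
have vb : v != b by rewrite -val_eqE gtn_eqF.
have Ka : ~~ (K %| a.-1).
  apply/negP=> Ka; have Kv1 : K %| 1.
    by rewrite -(dvdn_addr _ Ka); have <- : v.-1 = a.-1 + 1 by lia.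
  by move: K_gt1; rewrite dvdn1 in Kv1; rewrite (eqP Kv1).
have hub_a : (a.-1 %/ K * K).+1 = b.
  have /dvdnP[[|t]] := Kv; rewrite ?mulSn => vt; first by lia.
  have -> : a.-1 = t * K + K.-1 by lia.
  have K0 : 0 < K by exact: ltnW.
  by rewrite divnMDl // divn_small ?ltn_predL // addn0; lia.
have Bsub : B \subset [set v; a; b].
  have /and3P[_ _ /forall_inP/(_ b bB) cB] := ns.
  have vBb : v \in B :\ b by rewrite !inE vb.
  have : B :\ b \subset [set v; a].
    apply: (closed_induced_connected cB vBb); first by rewrite !inE eqxx.
    move=> p q; rewrite !in_set2 => pva /setD1P[pb pB] /setD1P[qb qB] pq.
    have qv := vmax q qB; have qb' : (q : nat) <> b by move/val_inj; apply/eqP.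
    case/orP: pva => /eqP pE; rewrite pE in pq.
      have /andP[_] := chain_rel_max vmax qB pq; rewrite Kv => /orP[/eqP q1|/eqP q1].
        by apply/orP; right; apply/eqP/val_inj/succn_inj; rewrite /= a1 q1.
      by case: qb'; apply: (@addIn K); rewrite bK.
    move: pq => /orP[/andP[aq _]|/andP[_]].
      by apply/orP; left; rewrite -val_eqE eqn_leq qv /= -a1.
    by rewrite (negPf Ka) hub_a => /eqP.
  move=> /subsetP sub; apply/subsetP=> p pB; rewrite in_setU in_set1 orbC.
  have [//|pb] := eqVneq p b; apply: sub.
  by rewrite !inE pb.
have adj_va : chain_rel v a.
  by apply/orP; right; rewrite /chain_lower Kv -a1 ltnSn eqxx.
have adj_vb : chain_rel v b.
  by apply/orP; right; rewrite /chain_lower Kv b_lt_v -bK eqxx orbT.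
have adj_ab : chain_rel a b.
  by apply/orP; right; rewrite /chain_lower (negPf Ka) b_lt_a hub_a eqxx.
have [csym cirr] := chain_simple.
move=> x xB; have adj y : y \in B -> y != x -> chain_rel x y.
  move=> /(subsetP Bsub) + yx; move/(subsetP Bsub): xB; rewrite !inE.
  move=> /orP[/orP[]|] /eqP xE /orP[/orP[]|] /eqP yE; move: yx; rewrite xE yE ?eqxx //.
  - by rewrite csym.
  - by rewrite csym.
  - by rewrite csym.
have B3 : #|B| <= 3.
  apply: leq_trans (subset_leq_card Bsub) _.
  by rewrite -setUA; apply: leq_trans (leq_card_setU _ _) _; rewrite cards1 cards2; case: eqP.
have -> : [set y in B | chain_rel x y] = B :\ x.
  apply/setP=> y; rewrite !inE andbC; have [->|yx] := eqVneq y x; first by rewrite cirr.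
  by have [yB|_] := boolP (y \in B); rewrite ?andbF // adj.
by move: B2 B3; rewrite (cardsD1 x) xB; lia.
Qed.

(** The largest vertex of [S] has at most two neighbours and at most [k] non-neighbours in [S],
    besides itself. *)
Lemma chain_no_dense k (S : {set 'I_N}) :
  S != set0 ->
  (forall x, x \in S -> #|[set y in S | (y != x) && ~~ chain_rel x y]| <= k) ->
  #|S| <= k + 3.
Proof.
move=> /exists_max[v vS vmax] /(_ v vS) dense.
have nv : #|nbr chain_rel S v| <= 2.
  have inn u : u \in nbr chain_rel S v -> chain_lower u v.
    by rewrite inE => /andP[uS vu]; apply: chain_rel_max vmax uS vu.
  have [Kv|Kv] := boolP (K %| v.-1).
    apply: (@card_le_values _ _ [:: v.-1; v - K]) => u /inn.
    rewrite /chain_lower Kv !inE => /andP[_ /orP[]] /eqP <-; first by rewrite eqxx.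
    by rewrite addnK eqxx orbT.
  apply: leq_trans (_ : 1 <= 2) => //.
  apply: (@card_le_values _ _ [:: (v.-1 %/ K * K).+1]) => u /inn.
  by rewrite /chain_lower (negPf Kv) inE => /andP[].
set X := [set y in S | _] in dense.
have sub : S \subset v |: (nbr chain_rel S v :|: X).
  apply/subsetP=> y yS; rewrite !inE yS /=.
  by have [//|yv] := eqVneq y v; case: (chain_rel v y).
apply: leq_trans (subset_leq_card sub) _; apply: leq_trans (leq_card_setU _ _) _.
rewrite cards1 add1n (addnS k) ltnS.
by apply: leq_trans (leq_card_setU _ _) _; rewrite addnC leq_add.
Qed.

(* If [S] contains a whole block [t * K + 1, ..., t * K + K], then it misses both
   lower neighbours of its hub, which lie in the previous block. *)
Lemma chain_sparse_prefix (S : {set 'I_N}) t :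
  (forall x, x \in S -> #|nbr chain_rel S x| < K) ->
  #|[set x in S | x <= t * K]| <= (t * K.-1).+1.
Proof.
move=> sparse; pose block t := [set x in S | t * K < x <= t * K + K].
have step t' : #|[set x in S | x <= t'.+1 * K]| =
    #|[set x in S | x <= t' * K]| + #|block t'|.
  rewrite -[LHS](cardsID [set x : 'I_N | x <= t' * K]); congr (_ + _).
    by apply: eq_card => x; rewrite !inE mulSn -andbA; congr (_ && _); lia.
  by apply: eq_card => x; rewrite !inE mulSn; case: (x \in S); lia.
have block_le t' (F : seq nat) : uniq F ->
    (forall u, u \in F -> t' * K < u <= t' * K + K) ->
    (forall x : 'I_N, x \in S -> val x \notin F) -> #|block t'| + size F <= K.
  move=> uF Fl SF; apply: (@card_interval _ (t' * K).+1) => //.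
  move=> x; rewrite inE => /and3P[xS x1 x2]; split; last exact: SF.
  by lia.
(* The hub of a full block already has [K - 1] neighbours in that block, the most that sparsity
   allows. *)
have full t' : K <= #|block t'| -> forall u : 'I_N, u \in S ->
    (u : nat) <> t' * K /\ (u + K) <> (t' * K).+1.
  move=> full u uS.
  have [h hS hE] : exists2 h : 'I_N, h \in S & (h : nat) = (t' * K).+1.
    have [/exists_inP[h hS /eqP hE]|no_h] :=
        boolP [exists h in S, (h : nat) == (t' * K).+1]; first by exists h.
    have : #|block t'| + 1 <= K; last by lia.
    apply: (block_le t' [:: (t' * K).+1]) => // [w|x xS].
      by rewrite inE => /eqP->; lia.
    by rewrite inE; apply: contra no_h => xE; apply/exists_inP; exists x.
  have hb : h \in block t' by rewrite inE hS hE; lia.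
  have hub_nbr : block t' :\ h \subset nbr chain_rel S h.
    apply/subsetP=> x; rewrite !inE => /and4P[xh xS x1 x2].
    have xh' : (x : nat) <> h by move/val_inj; apply/eqP.
    have hx : h < x by lia.
    rewrite xS; apply/orP; left; rewrite /chain_lower hx hE.
    have -> : x.-1 = t' * K + (x.-1 - t' * K) by lia.
    rewrite dvdn_addr ?dvdn_mull // divnMDl ?divn_small; [|lia..].
    by rewrite addn0 eqxx gtnNdvd //; lia.
  have no_nbr : u \notin block t' -> ~~ chain_rel h u.
    move=> ub; apply/negP=> hu; have := sparse h hS; rewrite ltnNge => /negP; apply.
    apply: leq_trans full _; rewrite (cardsD1 h (block t')) hb add1n.
    rewrite (_ : _.+1 = #|u |: (block t' :\ h)|); last first.
      by rewrite cardsU1 in_setD1 (negPf ub) andbF.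
    apply: subset_leq_card; rewrite subUset hub_nbr andbT sub1set inE uS.
    exact: hu.
  split=> uE.
    have /no_nbr/negP[] : u \notin block t' by rewrite inE uE ltnn andbF.
    apply/orP; right; rewrite /chain_lower hE /= dvdn_mull // uE ltnSn.
    by rewrite eqxx.
  have /no_nbr/negP[] : u \notin block t' by rewrite inE; lia.
  apply/orP; right; rewrite /chain_lower hE /= dvdn_mull // uE eqxx orbT andbT.
  by lia.
have le_block t' : #|block t'| <= K.
  by have := block_le t' [::] isT; rewrite addn0; apply.
have prefix0 : #|[set x in S | x <= 0 * K]| <= 1.
  apply: (@card_le_values _ _ [:: 0]) => x; rewrite !inE mul0n leqn0.
  by case/andP.
(* Two consecutive prefixes are bounded together: a full block has one vertex too many, and the
   block before it makes up for that by missing two. *)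
suff [] : #|[set x in S | x <= t * K]| <= (t * K.-1).+1 /\
          #|[set x in S | x <= t.+1 * K]| <= (t.+1 * K.-1).+1 by [].
elim: t => [|t [IH0 IH1]].
  split; first by rewrite mul0n.
  (* Below block [0] there is only vertex [0], which a full block [0] keeps out of [S]. *)
  have [full0|] := leqP K #|block 0|; last by rewrite step !mulSn; lia.
  rewrite step; have -> : #|[set x in S | x <= 0 * K]| = 0.
    apply/eqP; rewrite cards_eq0; apply/eqP/setP=> x; rewrite !inE mul0n leqn0.
    by apply/negP=> /andP[/(full _ full0)[]]; rewrite mul0n => x0 _ /eqP.
  by have := le_block 0; rewrite mul1n; lia.
split=> //; rewrite step.
have [fullt|] := leqP K #|block t.+1|; last by rewrite !mulSn in IH1 *; lia.
have : #|block t| + 2 <= K.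
  apply: (block_le t [:: t.+1 * K; (t * K).+1]).
  - by rewrite /= inE andbT mulSn; lia.
  - by move=> w; rewrite !inE mulSn => /orP[] /eqP->; lia.
  - move=> x xS; have [x1 x2] := full _ fullt x xS; rewrite !inE /= mulSn in x1 x2 *.
    by lia.
have := le_block t.+1; move: IH0; rewrite step !mulSn; lia.
Qed.

(** At least [t] of the [t * K + 1] vertices up to [t * K] are missing from [S]; all later vertices
    are counted as if they belonged to it. *)
Lemma chain_sparse_card (S : {set 'I_N}) t :
  t * K < N -> (forall x, x \in S -> #|nbr chain_rel S x| < K) -> #|S| + t <= N.
Proof.
move=> tN /(@chain_sparse_prefix S t) prefix.
have : #|S :\: [set x : 'I_N | x <= t * K]| + 0 <= N - (t * K).+1.
  apply: (@card_interval _ (t * K).+1 _ _ [::]) => // x; rewrite !inE -ltnNge.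
  by move=> /andP[xt _]; split=> //; have := ltn_ord x; lia.
have -> : #|S| = #|[set x in S | x <= t * K]| + #|S :\: [set x : 'I_N | x <= t * K]|.
  rewrite -(cardsID [set x : 'I_N | x <= t * K]); congr (_ + _).
  by apply: eq_card => x; rewrite !inE.
have : t * K = t * K.-1 + t by rewrite -{1}(ltn_predK K_gt1) mulnS addnC.
by lia.
Qed.

End Chain.

(** * The two Ramsey bounds and their arithmetic *)

Lemma cactus_ramsey_le k i j n : 2 <= k -> 0 < n ->
  (forall d, d * k.+1 < n -> j + d <= n) -> ramsey_prop_cacti k i j n.
Proof.
move=> k2 n0 nj T e [e_sym e_irr] cact Tn; right.
have T0 : [set: T] != set0 by rewrite -card_gt0 cardsT Tn.
have [D [_ Dlt Ds]] := sparse_deletion e_sym e_irr k2 cact T0.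
rewrite setTD cardsT Tn in Dlt Ds.
have jle : j <= #|~: D| by have := cardsC D; have := nj _ Dlt; rewrite Tn; lia.
have [S SD Sj] : exists2 S : {set T}, S \subset ~: D & #|S| = j.
  exists [set x in take j (enum (~: D))].
    by apply/subsetP=> x; rewrite inE => /mem_take; rewrite mem_enum.
  rewrite cardsE (card_uniqP _) ?take_uniq ?enum_uniq //.
  by rewrite size_takel // -cardE.
exists S; split=> // x xS; apply: leq_trans (Ds x (subsetP SD x xS)).
by apply/subset_leq_card/nbrS.
Qed.

(** The witness is the chain with [K = k + 1], truncated to [m] vertices. If [j <= m], a sparse set
    misses at least [t = m - j + 1] vertices, so fewer than [j] are left. *)
Lemma cactus_ramsey_gt k i j m : 2 <= k -> k + 4 <= i -> 0 < j ->
  (m < j \/ (m - j).+1 * k.+1 < m) -> ~ ramsey_prop_cacti k i j m.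
Proof.
move=> k2 ki j0 mj ramsey.
have K1 : 1 < k.+1 by lia.
have := ramsey 'I_m (@chain_rel k.+1 m) (@chain_simple _ _)
  (@chain_cactus _ _ K1) (card_ord m).
case=> [[S [Si dense]]|[S [Sj sparse]]].
  have S0 : S != set0 by rewrite -card_gt0; lia.
  by have := chain_no_dense S0 dense; lia.
have := subset_leq_card (subsetT S); rewrite cardsT card_ord Sj => jm.
case: mj => [|tm]; first by lia.
by have := chain_sparse_card K1 tm sparse; rewrite Sj; lia.
Qed.

Theorem theorem4p3 (j k i : nat) (hj : 2 <= j) (hk : 2 <= k) (hi : k + 4 <= i) :
  is_ramsey_number_cacti k i j (j - 1 + ceil_div (j - 1) k).
Proof.
rewrite /ceil_div; set c := _ %/ k.
have c_ge : j - 1 <= c * k.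
  have := divn_eq (j - 1 + k.-1) k; rewrite -/c.
  have : (j - 1 + k.-1) %% k < k by rewrite ltn_mod; lia.
  lia.
have c_le : c * k <= j - 1 + k.-1 by apply: leq_trunc_div.
split=> [|m mlt].
  (* Here [d >= c] would give [c * k < j - 1], contrary to [c_ge]. *)
  by apply: cactus_ramsey_le => // [|d dn]; [lia | nia].
apply: cactus_ramsey_gt => //; first lia.
have [mj|jm] := ltnP m j; [by left | right].
(* With [s = m - j + 1 <= c - 1] the goal amounts to [s * k < j - 1], and [c_le] gives
   [(c - 1) * k <= j - 2]. *)
nia.
Qed.
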